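(* $P(\omega)/\triangle_d$ has an $\omega$-limit.
   Context: $\omega$ is the set of non-negative integers. A set $A\subseteq\omega$ has asymptotic density zero if $\lim_{n\to\infty}\frac{|A\cap n|}{n}=0$ (where $n=\{0,\dots,n-1\}$); $\triangle_d$ is the ideal of subsets of $\omega$ of asymptotic density zero and $P(\omega)/\triangle_d$ is the quotient Boolean algebra. A descending chain $\{a_\alpha:\alpha<\gamma\}$ in a Boolean algebra $\mathbb{B}$ (that is, $a_\alpha>a_\beta$ whenever $\alpha<\beta<\gamma$) is called a $\gamma$-limit (a limit of length $\gamma$) if there is no positive (i.e. nonzero) $a\in\mathbb{B}$ such that $a<a_\alpha$ for each $\alpha<\gamma$. *)

(* Defs.v *)
From HB Require Import structures.
From mathcomp Require Import all_boot all_order all_algebra.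
From mathcomp Require Import boolp classical_sets functions reals topology normedtype.
From mathcomp Require Import sequences.
From mathcomp Require Import generic_quotient.

Set Implicit Arguments.
Unset Strict Implicit.
Unset Printing Implicit Defensive.

Import Order.TTheory GRing.Theory Num.Theory.
Import numFieldNormedType.Exports.

Local Open Scope classical_set_scope.
Local Open Scope ring_scope.
Local Open Scope quotient_scope.

Record set_ideal (T : Type) := SetIdeal {
  ideal_mem :> set T -> Prop;
  ideal0 : ideal_mem set0;
  idealS : forall A B, A `<=` B -> ideal_mem B -> ideal_mem A;
  idealU : forall A B, ideal_mem A -> ideal_mem B -> ideal_mem (A `|` B)
}.

Section PowerSetQuotient.
Variables (T : Type) (I : set_ideal T).

Definition eq_mod_ideal (A B : set T) : bool := `[< I (A `+` B) >].

Lemma eq_mod_ideal_refl : reflexive eq_mod_ideal.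
Proof. by move=> A; apply/asboolP; rewrite setYK; exact: ideal0. Qed.

Lemma eq_mod_ideal_sym : symmetric eq_mod_ideal.
Proof. by move=> A B; rewrite /eq_mod_ideal setYC. Qed.

Lemma eq_mod_ideal_trans : transitive eq_mod_ideal.
Proof.
move=> B A C /asboolP AB /asboolP BC; apply/asboolP.
apply: idealS (idealU AB BC) => x /=.
by have [] := pselect (B x); tauto.
Qed.

Canonical eq_mod_ideal_equiv :=
  EquivRel eq_mod_ideal eq_mod_ideal_refl eq_mod_ideal_sym eq_mod_ideal_trans.

Definition pset_quot : Type := {eq_quot eq_mod_ideal}.
HB.instance Definition _ := Choice.on pset_quot.
HB.instance Definition _ := EqQuotient.on pset_quot.

Implicit Types x y z : pset_quot.

Definition pset_cls (A : set T) : pset_quot := \pi A.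

Lemma pset_clsP A B : reflect (I (A `+` B)) (pset_cls A == pset_cls B).
Proof. by rewrite /pset_cls pi_eq_quot; exact: asboolP. Qed.

Definition quot_meet x y : pset_quot := pset_cls (repr x `&` repr y).
Definition quot_join x y : pset_quot := pset_cls (repr x `|` repr y).
Definition quot_compl x : pset_quot := pset_cls (~` repr x).
Definition quot_bot : pset_quot := pset_cls set0.
Definition quot_top : pset_quot := pset_cls setT.
Definition quot_le x y : bool := quot_meet x y == x.
Definition quot_lt x y : bool := (y != x) && quot_le x y.

Lemma repr_cls A : I (repr (pset_cls A) `+` A).
Proof. by apply/pset_clsP; rewrite /pset_cls reprK. Qed.

Lemma quot_meetE A B :
  quot_meet (pset_cls A) (pset_cls B) = pset_cls (A `&` B).
Proof.
apply/eqP/pset_clsP; apply: idealS (idealU (repr_cls A) (repr_cls B)) => t /=.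
by have [] := pselect (A t); have [] := pselect (B t);
   have [] := pselect (repr (pset_cls A) t);
   have [] := pselect (repr (pset_cls B) t); tauto.
Qed.

Lemma quot_joinE A B :
  quot_join (pset_cls A) (pset_cls B) = pset_cls (A `|` B).
Proof.
apply/eqP/pset_clsP; apply: idealS (idealU (repr_cls A) (repr_cls B)) => t /=.
by have [] := pselect (A t); have [] := pselect (B t);
   have [] := pselect (repr (pset_cls A) t);
   have [] := pselect (repr (pset_cls B) t); tauto.
Qed.

Lemma quot_complE A : quot_compl (pset_cls A) = pset_cls (~` A).
Proof.
apply/eqP/pset_clsP; apply: idealS (repr_cls A) => t /=.
by have [] := pselect (A t);
   have [] := pselect (repr (pset_cls A) t); tauto.
Qed.

Lemma pset_quotW (P : pset_quot -> Prop) :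
  (forall A, P (pset_cls A)) -> forall x, P x.
Proof. by move=> PA x; rewrite -[x]reprK; exact: PA. Qed.

Lemma quot_meetC : commutative quot_meet.
Proof. by elim/pset_quotW=> A; elim/pset_quotW=> B; rewrite !quot_meetE setIC. Qed.

Lemma quot_joinC : commutative quot_join.
Proof. by elim/pset_quotW=> A; elim/pset_quotW=> B; rewrite !quot_joinE setUC. Qed.

Lemma quot_meetA : associative quot_meet.
Proof.
elim/pset_quotW=> A; elim/pset_quotW=> B; elim/pset_quotW=> C.
by rewrite !quot_meetE setIA.
Qed.

Lemma quot_joinA : associative quot_join.
Proof.
elim/pset_quotW=> A; elim/pset_quotW=> B; elim/pset_quotW=> C.
by rewrite !quot_joinE setUA.
Qed.

Lemma quot_joinKI y x : quot_meet x (quot_join x y) = x.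
Proof.
elim/pset_quotW: x => A; elim/pset_quotW: y => B.
by rewrite quot_joinE quot_meetE setUC setKU.
Qed.

Lemma quot_meetKU y x : quot_join x (quot_meet x y) = x.
Proof.
elim/pset_quotW: x => A; elim/pset_quotW: y => B.
by rewrite quot_meetE quot_joinE setIC setKI.
Qed.

Lemma quot_meetUl : left_distributive quot_meet quot_join.
Proof.
elim/pset_quotW=> A; elim/pset_quotW=> B; elim/pset_quotW=> C.
by rewrite !(quot_joinE, quot_meetE) setIUl.
Qed.

Lemma quot_meetxx : idempotent_op quot_meet.
Proof. by elim/pset_quotW=> A; rewrite quot_meetE setIid. Qed.

Fact pset_quot_display : Order.disp_t. Proof. exact: Order.Disp tt tt. Qed.

HB.instance Definition _ :=
  Order.isMeetJoinDistrLattice.Build pset_quot_display pset_quot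
    (fun _ _ => erefl) (fun _ _ => erefl) quot_meetC quot_joinC
    quot_meetA quot_joinA quot_joinKI quot_meetKU quot_meetUl quot_meetxx.

Lemma quot_le0x x : (quot_bot <= x)%O.
Proof.
elim/pset_quotW: x => A; rewrite leEmeet; apply/eqP.
by rewrite [LHS]quot_meetE set0I.
Qed.

Lemma quot_lex1 x : (x <= quot_top)%O.
Proof.
elim/pset_quotW: x => A; rewrite leEmeet; apply/eqP.
by rewrite [LHS]quot_meetE setIT.
Qed.

HB.instance Definition _ :=
  Order.hasBottom.Build pset_quot_display pset_quot quot_le0x.
HB.instance Definition _ :=
  Order.hasTop.Build pset_quot_display pset_quot quot_lex1.

Lemma quot_joinxC x : (x `|` quot_compl x)%O = \top%O.
Proof.
elim/pset_quotW: x => A; rewrite quot_complE.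
by rewrite [LHS]quot_joinE setUv.
Qed.

Lemma quot_meetxC x : (x `&` quot_compl x)%O = \bot%O.
Proof.
elim/pset_quotW: x => A; rewrite quot_complE.
by rewrite [LHS]quot_meetE setICr.
Qed.

HB.instance Definition _ :=
  Order.TBDistrLattice_hasComplement.Build pset_quot_display pset_quot
    quot_joinxC quot_meetxC.

Lemma pset_cls_leP A B :
  reflect (I (A `\` B)) (pset_cls A <= pset_cls B :> pset_quot)%O.
Proof.
rewrite leEmeet.
suff -> : (A `\` B) = ((A `&` B) `+` A).
  by rewrite [X in X == _]quot_meetE; exact: pset_clsP.
by apply/seteqP; split=> t /=; tauto.
Qed.

Lemma pset_cls_eq0P A : reflect (I A) (pset_cls A == \bot%O).
Proof. by rewrite -{1}[A]setY0; exact: pset_clsP. Qed.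

End PowerSetQuotient.

Section Density.
Variable R : realType.

(* The junk value 0 / 0 at n = 0 does not affect the limit. *)
Definition density_zero (A : set nat) : Prop :=
  (fun n : nat => #|[pred i : 'I_n | (i : nat) \in A]|%:R / n%:R : R)
    @ \oo --> (0 : R).

Lemma density_zero0 : density_zero set0.
Proof.
rewrite /density_zero (_ : (fun _ => _) = fun=> 0); first exact: cvg_cst.
apply/funext => n; rewrite eq_card0 ?mul0r// => i.
by rewrite !inE; apply/negbTE/negP; rewrite in_setE.
Qed.

Lemma density_zeroS (A B : set nat) :
  A `<=` B -> density_zero B -> density_zero A.
Proof.
move=> AB B0; apply: (squeeze_cvgr _ (cvg_cst 0) B0).
near=> n; rewrite divr_ge0 //= ler_wpM2r ?invr_ge0 // ler_nat.
apply: subset_leq_card; apply/fintype.subsetP => i; rewrite !inE.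
exact: AB.
Unshelve. all: by end_near. Qed.

Lemma density_zeroU (A B : set nat) :
  density_zero A -> density_zero B -> density_zero (A `|` B).
Proof.
move=> A0 B0; have := cvgD A0 B0; rewrite addr0 => AB0.
apply: (squeeze_cvgr _ (cvg_cst 0) (AB0 _)).
near=> n; rewrite divr_ge0 //= fctE -mulrDl ler_wpM2r ?invr_ge0 // -natrD ler_nat.
rewrite -cardUI; apply: leq_trans (leq_addr _ _); apply: subset_leq_card.
apply/fintype.subsetP => i; rewrite !inE => -[Ai|Bi];
  apply/orP; [left|right]; exact: mem_set.
Unshelve. all: by end_near. Qed.

Definition density_ideal : set_ideal nat :=
  SetIdeal density_zero0 density_zeroS density_zeroU.

End Density.

(* The length of the chain is given by its index set J: an ordinal gamma is
   the well-ordered set of the ordinals below it, so J is nat, with its usual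
   order, for gamma = omega. *)
Definition is_limit d d' (J : orderType d) (B : ctbDistrLatticeType d')
    (a : J -> B) : Prop :=
  (forall i j : J, (i < j)%O -> (a j < a i)%O) /\
  ~ (exists b : B, (\bot < b)%O /\ forall i : J, (b < a i)%O).

Definition has_limit d d' (J : orderType d) (B : ctbDistrLatticeType d') : Prop :=
  exists a : J -> B, is_limit a.

(* Main.v *)
Require Import Defs.
From mathcomp Require Import all_boot all_order reals.
From mathcomp Require Import all_algebra boolp classical_sets topology normedtype.
From mathcomp Require Import zify.

(** The chain consists of the classes of the sets of multiples of [2 ^ i].

    It is strictly descending because, for [i < j], the multiples of [2 ^ i]
    that are not multiples of [2 ^ j] include the odd multiples of [2 ^ i], an
    arithmetic progression, and an arithmetic progression has positive density
    ([not_density_zero_progression]).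

    It has no positive lower bound: if [B] is contained in the multiples of
    [2 ^ i] up to a set of density zero, then its upper density is at most
    [2 ^- i].  When this holds for every [i], the set [B] has density zero
    ([density_zero_limit]).

    The estimates are carried out in [nat]: [A] has density zero exactly when,
    for every [k], the inequality [k * card_below A n <= n] holds for all
    sufficiently large [n] ([density_zeroP]). *)

Import Order.TTheory GRing.Theory Num.Theory.
Import numFieldNormedType.Exports.

Local Open Scope classical_set_scope.

Definition card_below (A : set nat) (n : nat) : nat :=
  #|[pred i : 'I_n | (i : nat) \in A]|.

Definition multiples (m : nat) : set nat := [set x | (m %| x)%N].

(** The bounds [1 / k] suffice to express convergence to zero because [R] is
    archimedean; multiplying out moves the estimate to [nat]. *)
Lemma density_zeroP (R : realType) (A : set nat) :
  density_zero R A <->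
  forall k : nat, \forall n \near \oo, (k * card_below A n <= n)%N.
Proof.
split=> [A0 k|A0].
  have k0 : (0 < k.+1%:R^-1 :> R)%R by rewrite invr_gt0 ltr0n.
  have /cvgr0Pnorm_lt/(_ _ k0) nA := A0; near=> n.
  have n0 : (0 < n)%N by near: n; exact: nbhs_infty_gt.
  have : (`|(card_below A n)%:R / n%:R| < k.+1%:R^-1 :> R)%R by near: n; exact: nA.
  rewrite ger0_norm ?divr_ge0// ltr_pdivrMr ?ltr0n// mulrC ltr_pdivlMr ?ltr0n//.
  by rewrite -natrM ltr_nat; nia.
apply/cvgr0Pnorm_lt => e e0.
have [k ke] : exists k : nat, (e^-1 < k%:R)%R.
  by exists (Num.truncn e^-1).+1; exact: truncnS_gt.
near=> n; rewrite /= -/(card_below A n).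
have n0 : (0 < n)%N by near: n; exact: nbhs_infty_gt.
have kAn : (k * card_below A n <= n)%N by near: n; exact: A0.
rewrite ger0_norm ?divr_ge0// ltr_pdivrMr ?ltr0n//.
have [->|c0] := posnP (card_below A n); first by rewrite mulr_gt0 ?ltr0n.
rewrite -ltr_pdivrMl//.
apply: lt_le_trans (_ : (k * card_below A n)%:R <= _)%R; last by rewrite ler_nat.
by rewrite natrM ltr_pM2r ?ltr0n.
Unshelve. all: by end_near. Qed.

Lemma card_below_split (A B : set nat) (n : nat) :
  (card_below B n <= card_below (B `\` A) n + card_below A n)%N.
Proof.
rewrite /card_below -cardUI; apply: leq_trans (leq_addr _ _).
apply: subset_leq_card; apply/fintype.subsetP => i; rewrite !inE => Bi.
have [Ai|nAi] := pselect (A i); apply/orP; first by right; exact: mem_set.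
by left; exact: mem_set.
Qed.

(** Division by [m] is injective on the multiples of [m]. *)
Lemma card_below_multiples (m n : nat) :
  (card_below (multiples m) n <= (n %/ m).+1)%N.
Proof.
pose f (i : 'I_n) : 'I_(n %/ m).+1 := inord (i %/ m).
rewrite /card_below -[leqRHS]card_ord -(@card_in_imset _ _ f) ?max_card//.
have fE i : f i = i %/ m :> nat by rewrite inordK// ltnS leq_div2r// ltnW.
move=> i j; rewrite !inE => mi mj /(congr1 val) /=; rewrite !fE => ij.
by apply: val_inj; rewrite /= -(divnK mi) -(divnK mj) ij.
Qed.

(** An initial segment of length [m * k] contains at least [k] terms of the
    progression. *)
Lemma not_density_zero_progression (R : realType) (A : set nat) (r m : nat) :
  (r < m)%N -> (forall k, A (r + m * k)%N) -> ~ density_zero R A.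
Proof.
move=> rm rmA /density_zeroP/(_ (m.*2)) [N _ AN].
have mN : (m * N.+1 >= N)%N by nia.
have {AN} := AN _ mN; rewrite /=.
suff : (N.+1 <= card_below A (m * N.+1))%N by nia.
have lt_f (i : 'I_N.+1) : (r + m * i < m * N.+1)%N by have := ltn_ord i; nia.
pose f i := Ordinal (lt_f i).
rewrite -[leqLHS]card_ord -(@card_imset _ _ f); last first.
  by move=> i j /(congr1 val) /= /addnI ij; apply: val_inj => /=; nia.
apply: subset_leq_card; apply/fintype.subsetP => _ /imsetP[i _ ->].
by rewrite !inE; exact: rmA.
Qed.

(** The odd multiples of [2 ^ i] witness that a step of the chain is strict. *)
Lemma not_density_zero_step (R : realType) (i j : nat) : (i < j)%N ->
  ~ density_zero R (multiples (2 ^ i) `\` multiples (2 ^ j)).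
Proof.
move=> ij; apply: (@not_density_zero_progression _ _ (2 ^ i) (2 ^ i.+1)).
  by rewrite ltn_exp2l.
move=> k; rewrite /multiples; split=> /=.
  by rewrite dvdn_addr// dvdn_mulr// dvdn_exp2l.
move=> /(dvdn_trans (dvdn_exp2l 2 ij)).
by rewrite dvdn_addl ?dvdn_mulr// dvdn_Pexp2l// ltnn.
Qed.

Lemma density_zero_limit (R : realType) (B : set nat) :
  (forall i, density_zero R (B `\` multiples (2 ^ i))) -> density_zero R B.
Proof.
move=> B0; apply/density_zeroP => k.
(* With modulus [m >= 4 * k], the part outside the multiples of [m] and the
   part inside each take up at most half of the allowance [n / k]; the bound
   [4 * k <= n] absorbs the extra multiple in [card_below_multiples]. *)
pose m := (2 ^ (4 * k))%N.
have km : (4 * k < m)%N by exact: ltn_expl.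
have /density_zeroP/(_ (2 * k)%N) Bm := B0 (4 * k)%N.
near=> n.
have kn : (4 * k <= n)%N by near: n; exact: nbhs_infty_ge.
have out : (2 * k * card_below (B `\` multiples m) n <= n)%N by near: n; exact: Bm.
have := card_below_split (multiples m) B n.
have := card_below_multiples m n.
have : (4 * k * (n %/ m) <= n)%N.
  by apply: leq_trans (leq_trunc_div n m); rewrite mulnC leq_mul2l (ltnW km) orbT.
nia.
Unshelve. all: by end_near. Qed.

Theorem proposition3 (R : realType) : has_limit nat (pset_quot (density_ideal R)).
Proof.
exists (fun i => pset_cls (density_ideal R) (multiples (2 ^ i))); split.
  move=> i j; rewrite ltEnat /= => ij; rewrite lt_leAnge; apply/andP; split.
    apply/pset_cls_leP; apply: idealS (ideal0 _) => x [/= jx]; apply.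
    by apply: dvdn_trans jx; rewrite dvdn_exp2l// ltnW.
  by apply/negP => /pset_cls_leP; exact: not_density_zero_step.
move=> [b []]; elim/pset_quotW: b => B; rewrite lt0x => /negP B0 Ba; apply: B0.
apply/pset_cls_eq0P; apply: density_zero_limit => i.
by have /ltW/pset_cls_leP := Ba i.
Qed.
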